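(* Let $G$ be a Garside group and $x\in G$. The following algorithm, applied to $x$, terminates and returns the set $C^*(x)$: (a) Compute some element $\tilde x\in C^*(x)$ and set $\mathcal{T}=\{T(\tilde x)\}$. (b) For each $T\in\mathcal{T}$ (including those members added to $\mathcal{T}$ during the procedure), choose some $y\in T$ and replace $\mathcal{T}$ by $\mathcal{T}\cup\{T(y^u)\mid u\in A(y)\}$. (c) When all members of $\mathcal{T}$ have been processed, return $\bigcup_{T\in\mathcal{T}}T$.
   Context: Garside groups. A monoid $M$ is atomic if it is generated by its atoms (elements $x\ne1$ such that $x=yz$ implies $y=1$ or $z=1$) and every $x\in M$ has a finite norm $\|x\|$, the maximal number of factors in an expression of $x$ as a product of atoms. A Garside monoid is a cancellative atomic monoid $M$ in which any two elements have left and right greatest common divisors and left and right least common multiples, together with a Garside element $\Delta\in M$: its left divisors coincide with its right divisors, and they form a finite set $S$ (the simple elements) generating $M$. A Garside group $G$ is the group of fractions of a Garside monoid $M$. For $x,y\in G$, $x\prec y$ means $x^{-1}y\in M$ (a partial order on $G$), and $x\wedge y$, $x\vee y$ are the greatest lower bound and least upper bound with respect to $\prec$. Write $x^u=u^{-1}xu$. For $q\in\mathbb{Z}$ the cycling operation of order $q$ is $\mathrm{c}_q(x)=x^{x\wedge\Delta^q}$, and $G_q=\{x\in G\mid \mathrm{c}_q^N(x)=x\text{ for some }N>0\}$. With $C(x)$ the conjugacy class of $x$, the fully refined summit set is $C^*(x)=C(x)\cap\bigcap_{q\in\mathbb{Z}}G_q$ (it is nonempty). For $y\in G$, $A(y)$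 denotes the set of $\prec$-minimal elements of $\{u\in S\setminus\{1\}\mid y^u\in C^*(y)\}$. The full cycling trajectory of $y\in G$ is $$T(y)=\{\mathrm{c}_{q_k}\cdots\mathrm{c}_{q_2}\mathrm{c}_{q_1}(y)\mid q_i\in\mathbb{Z},\ k\ge0\}.$$ *)

(* Defs.v *)
From HB Require Import structures.
From mathcomp Require Import all_boot.
From mathcomp Require Import ssrint.
From mathcomp Require Import boolp classical_sets cardinality.
From Stdlib Require Import Relation_Operators.

Set Implicit Arguments.
Unset Strict Implicit.
Unset Printing Implicit Defensive.

Local Open Scope classical_set_scope.
Local Open Scope group_scope.

Section GarsideMonoids.
Context {M : monoidType}.
Implicit Types (x y z a b d e : M) (dvd : M -> M -> Prop).

Definition atom x := x <> 1 /\ forall y z, x = y * z -> y = 1 \/ z = 1.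

Definition atomic_expr x (s : seq M) :=
  (forall a, a \in s -> atom a) /\ x = \prod_(a <- s) a.

Definition is_norm x n :=
  (exists2 s, atomic_expr x s & size s = n) /\
  (forall s, atomic_expr x s -> (size s <= n)%N).

Definition atomic_monoid :=
  (forall x, exists s, atomic_expr x s) /\ (forall x, exists n, is_norm x n).

Definition cancellative :=
  (forall x y z, x * y = x * z -> y = z) /\
  (forall x y z, y * x = z * x -> y = z).

Definition ldvd x y := exists z, y = x * z.
Definition rdvd x y := exists z, y = z * x.

Definition is_gcd dvd x y d :=
  [/\ dvd d x, dvd d y & forall e, dvd e x -> dvd e y -> dvd e d].
Definition is_lcm dvd x y d :=
  [/\ dvd x d, dvd y d & forall e, dvd x e -> dvd y e -> dvd d e].

Definition has_gcds_lcms dvd :=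
  forall x y, (exists d, is_gcd dvd x y d) /\ (exists d, is_lcm dvd x y d).

Definition generates (S : set M) :=
  forall x, exists s : seq M,
    (forall a, a \in s -> S a) /\ x = \prod_(a <- s) a.

Definition garside_element (Delta : M) :=
  [/\ forall a, ldvd a Delta <-> rdvd a Delta,
      finite_set [set a | ldvd a Delta] &
      generates [set a | ldvd a Delta]].

Definition garside_monoid (Delta : M) :=
  [/\ cancellative, atomic_monoid, has_gcds_lcms ldvd, has_gcds_lcms rdvd &
      garside_element Delta].

End GarsideMonoids.

(* The monoid may be identified with its image under i; by Ore's theorem this
   determines the group up to isomorphism. *)
Definition group_of_fractions (M : monoidType) (G : groupType) (i : M -> G) :=
  [/\ monoid_morphism i, injective i &
      forall g, exists a b, g = (i a)^-1 * i b].

Record garsideGroup := GarsideGroup {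
  gg_sort :> groupType;
  gg_monoid : monoidType;
  gg_incl : gg_monoid -> gg_sort;
  gg_Delta : gg_monoid;
  gg_garside : garside_monoid gg_Delta;
  gg_fractions : group_of_fractions gg_incl
}.

Definition expgz (G : groupType) (x : G) (q : int) : G :=
  match q with Posz n => x ^+ n | Negz n => x ^- n.+1 end.

Section GarsideGroups.
Context {G : garsideGroup}.
Implicit Types (x y z u v : G) (q : int) (T : set G).

Definition prec x y := range (@gg_incl G) (x^-1 * y).

Definition is_meet x y z :=
  [/\ prec z x, prec z y & forall w, prec w x -> prec w y -> prec w z].

(* The default value 1 is never used: in a Garside group any two elements have
   a (necessarily unique) greatest lower bound. *)
Definition meet x y : G := xget 1 [set z | is_meet x y z].

Definition DeltaG : G := gg_incl (gg_Delta G).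

Definition simple : set G := @gg_incl G @` [set a | ldvd a (gg_Delta G)].

Definition cycling q x : G := x ^ meet x (expgz DeltaG q).

Definition periodic q : set G :=
  [set x | exists2 N, (0 < N)%N & iter N (cycling q) x = x].

Definition conj_class x : set G := [set x ^ u | u in [set: G]].

Definition Cstar x : set G := conj_class x `&` \bigcap_q periodic q.

Definition summit_simples y : set G :=
  [set u | [/\ simple u, u <> 1 & Cstar y (y ^ u)]].

Definition minimal_simples y : set G :=
  [set u | summit_simples y u /\
           forall v, summit_simples y v -> prec v u -> v = u].

Definition trajectory y : set G :=
  [set foldl (fun z q => cycling q z) y qs | qs in [set: seq int]].

(* Members of the family are sets, compared by their elements: if some
   trajectory (y ^ u) coincides with an already processed member, it is not
   processed again. *)
Record state := State {
  trajs : set (set G);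
  processed : set (set G)
}.

Inductive initial x : state -> Prop :=
| Initial xt of Cstar x xt : initial x (State [set trajectory xt] set0).

Inductive step (s : state) : state -> Prop :=
| Step T y of trajs s T & ~ processed s T & T y :
    step s (State
      (trajs s `|` [set trajectory (y ^ u) | u in minimal_simples y])
      (processed s `|` [set T])).

Definition reachable x (t : state) :=
  exists2 s, initial x s & clos_refl_trans _ step s t.

Definition halted (s : state) := trajs s `<=` processed s.

Definition output (s : state) : set G := \bigcup_(T in trajs s) T.

Definition finite_state (s : state) :=
  finite_set (trajs s) /\ (forall T, trajs s T -> finite_set T).

(* The choices of the initial element, of the next unprocessed trajectory and
   of an element of it are all nondeterministic, so this speaks of every run:
   the algorithm can start, never gets stuck before halting, has no infinite
   run, and any halting state outputs R.  The states are required to be finite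
   because bounding the number of steps does not by itself rule out infinite
   trajectories, which no procedure could compute or return. *)
Definition terminates_and_returns x (R : set G) :=
  [/\ exists s, initial x s,
      forall s, initial x s -> Acc (fun t' t => step t t') s,
      forall t, reachable x t -> finite_state t,
      forall t, reachable x t -> ~ halted t -> exists t', step t t' &
      forall t, reachable x t -> halted t -> output t = R].

End GarsideGroups.

(* Main.v *)
Require Import Defs.
From mathcomp Require Import all_boot.
From mathcomp Require Import ssralg ssrnum ssrint.
From mathcomp Require Import boolp classical_sets cardinality.
From mathcomp Require Import zify.
From Stdlib Require Import Relation_Operators.

Set Implicit Arguments.
Unset Strict Implicit.
Unset Printing Implicit Defensive.

(* A conjugator [u] from [y] to [y ^ u] is transported by the cycling of order
   [q] to the conjugator [(y meet Delta^q)^-1 u (y^u meet Delta^q)] from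
   [c_q(y)] to [c_q(y^u)].  Since this equals
   [(y meet Delta^q)^-1 (y u meet u Delta^q)], transport preserves the order and
   meets, fixes the powers of [Delta], and sends [y] to [c_q(y)].  It follows
   that cyclings commute and preserve every interval [[Delta^a, Delta^b]], and
   that [C*(x)] is nonempty, finite and stable under cyclings.  As transport
   permutes the finite set of pairs [(y, u)] with [y] and [y^u] in [C*(x)] and
   [1 <= u <= Delta^m], the positive conjugators from [y] into [C*(x)] are closed
   under meets, so [C*(x)] is connected by minimal simple conjugators, and the
   minimal simple conjugators at [y] represent those at every point of [T(y)]. *)

Local Open Scope classical_set_scope.
Local Open Scope group_scope.

(** * Periodic points of self-maps of finite sets *)

Lemma finite_sequence_repeats (T : Type) (A : set T) (v : nat -> T) :
  finite_set A -> (forall n, A (v n)) ->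
  exists i j, (i < j)%N /\ v i = v j.
Proof.
move=> finA vA; apply: contrapT => norep; apply: infinite_nat.
suff -> : [set: nat] = v @^-1` A.
  apply: finite_preimage => // i j _ _ eqv; apply: contrapT => /eqP.
  rewrite neq_ltn => /orP[ij|ji]; apply: norep.
    by exists i, j.
  by exists j, i.
by apply/seteqP; split=> // n _; apply: vA.
Qed.

Lemma iter_in (T : Type) (A : set T) (f : T -> T) :
  (forall a, A a -> A (f a)) -> forall n a, A a -> A (iter n f a).
Proof. by move=> fA n a Aa; elim: n => //= n; apply: fA. Qed.

Lemma iter_eventually_periodic (T : Type) (A : set T) (f : T -> T) (a : T) :
  finite_set A -> (forall b, A b -> A (f b)) -> A a ->
  exists i, exists2 N, (0 < N)%N & iter N f (iter i f a) = iter i f a.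
Proof.
move=> finA fA Aa.
have [i [j [ij eqij]]] := finite_sequence_repeats (v := fun n => iter n f a)
  finA (fun n => iter_in fA n Aa).
exists i, (j - i)%N; first by rewrite subn_gt0.
by rewrite -iterD subnK ?eqij // ltnW.
Qed.

Lemma finite_injection_periodic (T : eqType) (A : set T) (f : T -> T) :
  finite_set A -> (forall a, A a -> A (f a)) ->
  (forall a b, A a -> A b -> f a = f b -> a = b) ->
  exists2 N, (0 < N)%N & forall a, A a -> iter N f a = a.
Proof.
move=> finA fA injf.
(* Injectivity strips the pre-period [i] off one application of [f] at a time. *)
have periodic_pt a : A a -> exists2 N, (0 < N)%N & iter N f a = a.
  move=> Aa; have [i [N N0 eqN]] := iter_eventually_periodic finA fA Aa.
  exists N => //; elim: i eqN => // i IHi; rewrite -iterD addnS !iterS iterD.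
  by move/injf=> eqN; apply/IHi/eqN; do ?apply: iter_in.
have /finite_seqP[s eqA] := finA.
suff [N N0 fN] : exists2 N, (0 < N)%N &
    forall a, a \in s -> A a -> iter N f a = a.
  by exists N => // a Aa; apply: fN => //; rewrite eqA in Aa.
elim: s {eqA} => [|b s [N N0 IHs]]; first by exists 1%N.
have [Ab|nAb] := pselect (A b); last first.
  exists N => // a; rewrite inE => /orP[/eqP->|]; [by move/nAb|exact: IHs].
have [N' N'0 fb] := periodic_pt b Ab.
(* The product of the periods of the listed points is a common period. *)
exists (N * N')%N; first by rewrite muln_gt0 N0.
move=> a; rewrite inE => /orP[/eqP-> _|sa Aa].
  by rewrite iterM; elim: (N) => //= n ->.
by rewrite mulnC iterM; elim: (N') => //= n ->; apply: IHs.
Qed.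

(** * Norms, atoms and divisors in a Garside monoid *)

Section GarsideMonoidTheory.
Context {M : monoidType} {Delta : M}.
Hypothesis garside : garside_monoid Delta.

Lemma atomic_monoid_conical (a b : M) : a * b = 1 -> a = 1.
Proof.
have [_ [atoms norms] _ _ _] := garside => ab1.
have [s [atom_s def_a]] := atoms a; have [t [atom_t def_b]] := atoms b.
have [n [_ norm1]] := norms 1.
(* If [a] were not 1, the expansion of [(a * b)^(n+1) = 1] into atoms would have more than [n]
   factors, against the norm [n] of 1. *)
have: atomic_expr (1 : M) (flatten (nseq n.+1 (s ++ t))).
  split=> [c /flattenP[w /nseqP[-> _]]|].
    by rewrite mem_cat => /orP[/atom_s|/atom_t].
  elim: n.+1 => [|k IHk]; first by rewrite big_nil.
  by rewrite /= !big_cat /= -IHk -def_a -def_b ab1 mulg1.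
move/norm1; rewrite size_flatten /shape map_nseq sumn_nseq size_cat.
case: s def_a {atom_s} => [->|c s _]; first by rewrite big_nil.
by rewrite /= mulSn mulnS -!addnA; move/leP; lia.
Qed.

(** Write the atom as a product of simple elements: irreducibility discards trivial factors until a
    single simple factor remains. *)
Lemma atom_ldvd_garside (a : M) : atom a -> ldvd a Delta.
Proof.
have [_ _ _ _ [_ _ genD]] := garside; move=> [a1 irr].
have [s [simple_s def_a]] := genD a.
elim: s def_a simple_s => [|b s IHs]; first by rewrite big_nil => /a1.
rewrite big_cons => def_a simple_bs; case: (irr _ _ def_a) => [b1|s1].
  apply: IHs => [|c sc]; first by rewrite {1}def_a b1 mul1g.
  by apply: simple_bs; rewrite inE sc orbT.
by rewrite def_a s1 mulg1; apply: simple_bs; rewrite mem_head.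
Qed.

Lemma finite_atoms : finite_set [set a : M | atom a].
Proof.
have [_ _ _ _ [_ finD _]] := garside.
exact: sub_finite_set atom_ldvd_garside finD.
Qed.

Lemma finite_short_products n :
  finite_set [set a : M | exists s, atomic_expr a s /\ (size s <= n)%N].
Proof.
elim: n => [|n IHn].
  apply: sub_finite_set (finite_set1 1) => a [s [[_ ->]]].
  by rewrite leqn0 => /nilP->; rewrite big_nil.
have finX := finite_image (fun bc : M * M => bc.1 * bc.2)
  (finite_setX finite_atoms IHn).
have finU : finite_set [set (1 : M)] by apply: finite_set1.
have := conj finU finX; rewrite -finite_setU; apply: sub_finite_set.
move=> a [[|b s] [[atom_s ->]]]; first by rewrite big_nil; left.
rewrite big_cons /= ltnS => size_s; right.
exists (b, \prod_(c <- s) c) => //; split; first by apply: atom_s; rewrite mem_head.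
exists s; split=> //; split=> // c sc.
by apply: atom_s; rewrite inE sc orbT.
Qed.

(** The norm of [d] bounds the number of atoms in a divisor, and there are finitely many atoms. *)
Lemma finite_left_divisors (d : M) : finite_set [set a | ldvd a d].
Proof.
have [_ [atoms norms] _ _ _] := garside; have [n [_ norm_d]] := norms d.
apply: sub_finite_set (finite_short_products n) => a [b def_d].
have [s [atom_s def_a]] := atoms a; have [t [atom_t def_b]] := atoms b.
exists s; split=> //; apply: leq_trans (norm_d (s ++ t) _).
  by rewrite size_cat leq_addr.
split; last by rewrite big_cat /= -def_a -def_b.
by move=> c; rewrite mem_cat => /orP[/atom_s|/atom_t].
Qed.

(** The norm itself is such a function, since maximal expressions concatenate; it is the measure for
    later descents on conjugators. *)
Lemma ex_length : exists len : M -> nat,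
  (forall a b, (len a + len b <= len (a * b)%g)%N) /\
  (forall a, len a = 0%N -> a = 1).
Proof.
have [_ [atoms norms] _ _ _] := garside; have [len norm_len] := choice norms.
exists len; split=> [a b|a len0]; last first.
  have [s [atom_s def_a]] := atoms a; have [_ /(_ s)] := norm_len a.
  by rewrite len0 leqn0 def_a => /(_ (conj atom_s erefl))/nilP->; rewrite big_nil.
have [[s [atom_s def_a] <-] _] := norm_len a.
have [[t [atom_t def_b] <-] _] := norm_len b.
have [_ max_ab] := norm_len (a * b); rewrite -size_cat; apply: max_ab.
split; last by rewrite big_cat /= -def_a -def_b.
by move=> c; rewrite mem_cat => /orP[/atom_s|/atom_t].
Qed.

Lemma atom_factor (a : M) : a <> 1 -> exists b c, atom b /\ a = b * c.
Proof.
have [_ [atoms _] _ _ _] := garside; have [s [atom_s ->]] := atoms a.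
case: s atom_s => [|b s] atom_bs; first by rewrite big_nil.
move=> _; exists b, (\prod_(c <- s) c); rewrite big_cons; split=> //.
by apply: atom_bs; rewrite mem_head.
Qed.

End GarsideMonoidTheory.

(** * The order of a Garside group: powers of Delta, finite intervals and meets *)

Section GarsideOrder.
Context {G : garsideGroup}.
Implicit Types (x y z u v w g : G) (p q : int).

Local Notation i := (@gg_incl G).
Local Notation Delta := (gg_Delta G).
Local Notation pos := (range i).
Local Notation D := (expgz (@DeltaG G)).

Lemma incl1 : i 1 = 1. Proof. by have [[]] := gg_fractions G. Qed.
Lemma inclM a b : i (a * b) = i a * i b.
Proof. by have [[_ ->]] := gg_fractions G. Qed.
Lemma incl_inj : injective i. Proof. by have [] := gg_fractions G. Qed.

Lemma pos1 : pos 1. Proof. by exists 1 => //; rewrite incl1. Qed.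

Lemma posM g h : pos g -> pos h -> pos (g * h).
Proof. by move=> [a _ <-] [b _ <-]; exists (a * b) => //; rewrite inclM. Qed.

Lemma pos_conical g h : pos g -> pos h -> g * h = 1 -> g = 1.
Proof.
move=> [a _ <-] [b _ <-]; rewrite -inclM -incl1 => /incl_inj.
by move/(atomic_monoid_conical (gg_garside G))->.
Qed.

Lemma prec_refl x : prec x x.
Proof. by rewrite /prec mulVg; apply: pos1. Qed.

Lemma prec_trans y x z : prec x y -> prec y z -> prec x z.
Proof. by move=> /posM + yz => /(_ _ yz); rewrite /prec mulgA mulgK. Qed.

Lemma prec_anti x y : prec x y -> prec y x -> x = y.
Proof.
move=> xy yx; have := pos_conical xy yx; rewrite mulgA mulgK mulVg => /(_ erefl).
by move/mulg1_eq; rewrite invgK.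
Qed.

Lemma prec_mul2l g x y : prec (g * x) (g * y) = prec x y.
Proof. by rewrite /prec invgM -mulgA mulKg. Qed.

Lemma prec1 x : prec 1 x = pos x. Proof. by rewrite /prec invg1 mul1g. Qed.

Lemma prec_mulr x g : pos g -> prec x (x * g).
Proof. by rewrite /prec mulKg. Qed.

Lemma pos_generated (P : G -> Prop) :
  P 1 -> (forall g h, P g -> P h -> P (g * h)) ->
  (forall a, ldvd a Delta -> P (i a)) -> forall g, pos g -> P g.
Proof.
have [_ _ _ _ [_ _ genD]] := gg_garside G.
move=> P1 PM PS _ [a _ <-]; have [s [simple_s ->]] := genD a.
elim: s simple_s => [|b s IHs] simple_bs; first by rewrite big_nil incl1.
rewrite big_cons inclM; apply: PM; first by apply: PS (simple_bs _ (mem_head _ _)).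
by apply: IHs => c sc; apply: simple_bs; rewrite inE sc orbT.
Qed.

Lemma pos_Delta : pos (@DeltaG G). Proof. by exists Delta. Qed.

(** If [Delta = a * b], the right divisor [b] is also a left divisor, [Delta = b * c]; then
    [a * Delta = Delta * c]. *)
Lemma simple_conj_Delta a : ldvd a Delta ->
  exists2 c, ldvd c Delta & i a ^ DeltaG = i c.
Proof.
have [_ _ _ _ [lr _ _]] := gg_garside G; move=> [b def_ab].
have [c def_bc] : ldvd b Delta by apply/lr; exists a.
exists c; first by apply/lr; exists b.
by rewrite /conjg /DeltaG {2}def_bc inclM [i a * _]mulgA -inclM -def_ab mulKg.
Qed.

Lemma simple_conj_DeltaV c : ldvd c Delta ->
  exists2 a, ldvd a Delta & i c ^ DeltaG^-1 = i a.
Proof.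
have [_ _ _ _ [lr _ _]] := gg_garside G; move=> /lr[b def_bc].
have [a def_ab] : rdvd b Delta by apply/lr; exists c.
exists a; first by exists b.
apply: (canLR (conjgK _)); apply/esym.
rewrite /conjg /DeltaG {2}def_bc inclM [i a * _]mulgA.
by rewrite -inclM -def_ab mulKg.
Qed.

Lemma pos_conj_Delta g : pos g -> pos (g ^ DeltaG).
Proof.
move: g; apply: pos_generated.
- by rewrite conj1g; apply: pos1.
- by move=> g h ? ?; rewrite conjMg; apply: posM.
- by move=> a /simple_conj_Delta[c _ ->]; exists c.
Qed.

Lemma pos_conj_DeltaV g : pos g -> pos (g ^ DeltaG^-1).
Proof.
move: g; apply: pos_generated.
- by rewrite conj1g; apply: pos1.
- by move=> g h ? ?; rewrite conjMg; apply: posM.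
- by move=> a /simple_conj_DeltaV[c _ ->]; exists c.
Qed.

Lemma expgzS q : D (q + 1)%R = D q * DeltaG.
Proof.
case: q => [n|[|n]]; first by rewrite -PoszD addn1 /= expgSr.
  by rewrite /= expg1 mulVg.
rewrite (_ : (Negz n.+1 + 1)%R = Negz n) /=; last by rewrite !NegzE; lia.
by rewrite [in RHS]expgS invgM mulgVK.
Qed.

Lemma expgzB1 q : D (q - 1)%R = D q * DeltaG^-1.
Proof. by rewrite -[in RHS](GRing.subrK 1%R q) expgzS mulgK. Qed.

Lemma expgzD p q : D (p + q)%R = D p * D q.
Proof.
elim: q => [|n IHn|n IHn]; first by rewrite GRing.addr0 mulg1.
  by rewrite -addn1 PoszD GRing.addrA !expgzS IHn mulgA.
by rewrite -addn1 PoszD GRing.opprD GRing.addrA !expgzB1 IHn mulgA.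
Qed.

Lemma expgzN q : D (- q)%R = (D q)^-1.
Proof. by apply/esym/mulg1_eq; rewrite -expgzD GRing.subrr. Qed.

Lemma expgz_comm p q : D p * D q = D q * D p.
Proof. by rewrite -!expgzD GRing.addrC. Qed.

Lemma expgz_conj p q : D p ^ D q = D p.
Proof. by rewrite /conjg expgz_comm mulKg. Qed.

Lemma iter_conj_expgz n q x : iter n (fun g => g ^ D q) x = x ^ D (n%:Z * q)%R.
Proof.
elim: n => [|n IHn]; first by rewrite GRing.mul0r conjg1.
by rewrite iterS IHn -conjgM -expgzD -addn1 PoszD GRing.mulrDl GRing.mul1r.
Qed.

Lemma pos_conj_expgz q g : pos (g ^ D q) = pos g.
Proof.
have pos_conj p h : pos h -> pos (h ^ D p).
  elim: p h => [|n IHn|n IHn] h; first by rewrite conjg1.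
    by rewrite -addn1 PoszD expgzS conjgM => /IHn/pos_conj_Delta.
  by rewrite -addn1 PoszD GRing.opprD expgzB1 conjgM => /IHn/pos_conj_DeltaV.
apply/propext; split; last exact: pos_conj.
by move/(pos_conj (- q)%R); rewrite expgzN conjgK.
Qed.

(** The order is left invariant by definition; powers of Delta may also act on the right because
    conjugation by them preserves positivity. *)
Lemma prec_mul2r q x y : prec (x * D q) (y * D q) = prec x y.
Proof.
by rewrite /prec -[in RHS](pos_conj_expgz q) /conjg invgM !mulgA.
Qed.

Lemma prec_conj2 q x y : prec (x ^ D q) (y ^ D q) = prec x y.
Proof. by rewrite !conjgE prec_mul2l prec_mul2r. Qed.

Lemma prec_expgz p q : (p <= q)%R -> prec (D p) (D q).
Proof.
move=> pq; rewrite -(GRing.subrK p q) GRing.addrC expgzD; apply: prec_mulr.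
rewrite -Num.Theory.subr_ge0 in pq; case: (q - p)%R pq => // n _.
elim: n => [|n IHn]; first exact: pos1.
by rewrite -addn1 PoszD expgzS; apply: posM => //; apply: pos_Delta.
Qed.

Lemma prec_invl q g : prec g (D q) = prec (D (- q)%R) g^-1.
Proof.
rewrite /prec -[in LHS](pos_conj_expgz (- q)%R) expgzN invgK /conjg invgK.
by rewrite mulgK.
Qed.

Lemma pos_bounded g : pos g -> exists n : nat, prec g (D n).
Proof.
move: g; apply: pos_generated => [|g h [m gm] [n hn]|a [b def_ab]].
- by exists 0%N; apply: prec_refl.
- exists (m + n)%N; apply: (@prec_trans (g * D n)); first by rewrite prec_mul2l.
  by rewrite PoszD expgzD prec_mul2r.
- by exists 1%N; rewrite /prec /= expg1 /DeltaG def_ab inclM mulKg; exists b.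
Qed.

(** A fraction [a^-1 * b] lies above [a^-1], and an upper bound of [a] inverts to a lower bound of
    [a^-1]. *)
Lemma lower_bounded g : exists n : nat, prec (D (- n%:Z)%R) g.
Proof.
have [_ _ /(_ g)[a [b ->]]] := gg_fractions G.
have [|n an] := @pos_bounded (i a); first by exists a.
exists n; apply: (@prec_trans (i a)^-1); first by rewrite -prec_invl.
by apply: prec_mulr; exists b.
Qed.

Lemma bounded g : exists n : nat, prec (D (- n%:Z)%R) g /\ prec g (D n).
Proof.
have [m mg] := lower_bounded g; have [n ng] := lower_bounded g^-1.
exists (maxn m n); rewrite prec_invl; split.
  by apply: prec_trans mg; apply: prec_expgz; lia.
by apply: prec_trans ng; apply: prec_expgz; lia.
Qed.

(** Left translation by [x] reduces the interval to the left divisors of [x^-1 * y]. *)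
Lemma finite_interval x y : finite_set [set z | prec x z /\ prec z y].
Proof.
have [xy|nxy] := pselect (prec x y); last first.
  by apply: sub_finite_set (finite_set0 _) => z [xz /(prec_trans xz)].
have [d _ def_d] := xy.
apply: sub_finite_set (finite_image (fun a => x * i a)
  (finite_left_divisors (gg_garside G) d)) => z [[a _ def_a] [b _ def_b]].
exists a; last by rewrite def_a mulVKg.
by exists b; apply: incl_inj; rewrite inclM def_a def_b def_d mulgA mulgK.
Qed.

Lemma ex_meet x y : exists z, is_meet x y z.
Proof.
have common u v : exists2 w, prec w u & prec w v.
  have [m mu] := lower_bounded u; have [n nv] := lower_bounded v.
  exists (D (- (maxn m n)%:Z)%R).
    by apply: prec_trans mu; apply: prec_expgz; lia.
  by apply: prec_trans nv; apply: prec_expgz; lia.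
(* Only the lower bounds above a given [h] are controlled by a gcd in the
   monoid, so comparing with an arbitrary one requires a smaller [h]. *)
have rel_meet h : prec h x -> prec h y -> exists z,
    [/\ prec h z, prec z x, prec z y &
      forall w, prec h w -> prec w x -> prec w y -> prec w z].
  move=> [a _ def_a] [b _ def_b]; have [_ _ gcds _ _] := gg_garside G.
  have [[d [[a' def_a'] [b' def_b'] gcd_d]] _] := gcds a b.
  exists (h * i d); split.
  - by apply: prec_mulr; exists d.
  - by exists a' => //; rewrite invgM -mulgA -def_a def_a' inclM mulKg.
  - by exists b' => //; rewrite invgM -mulgA -def_b def_b' inclM mulKg.
  - move=> w [e _ def_e] [a'' _ def_a''] [b'' _ def_b''].
    have [||f def_d] := gcd_d e.
    + by exists a''; apply: incl_inj; rewrite inclM def_e def_a'' def_a mulgA mulgK.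
    + by exists b''; apply: incl_inj; rewrite inclM def_e def_b'' def_b mulgA mulgK.
    + by exists f => //; rewrite def_d inclM def_e -mulgA mulVKg mulKg.
have [g gx gy] := common x y; have [z [gz zx zy max_z]] := rel_meet g gx gy.
(* The meet [z'] relative to a bound [h] below both [g] and [w] dominates [z], hence [g], so it is
   in turn below [z]. *)
exists z; split=> // w wx wy; have [h hg hw] := common g w.
have [z' [_ z'x z'y max_z']] := rel_meet h (prec_trans hg gx) (prec_trans hg gy).
have zz' : prec z z' by apply: max_z' => //; apply: prec_trans gz.
apply: prec_trans (max_z z' _ z'x z'y); first exact: max_z'.
exact: prec_trans zz'.
Qed.

Lemma meetP x y : is_meet x y (meet x y).
Proof. exact: (xgetPex 1 (ex_meet x y)). Qed.

Lemma meet_precl x y : prec (meet x y) x. Proof. by have [] := meetP x y. Qed.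
Lemma meet_precr x y : prec (meet x y) y. Proof. by have [] := meetP x y. Qed.

Lemma prec_meet w x y : prec w x -> prec w y -> prec w (meet x y).
Proof. by have [_ _] := meetP x y; apply. Qed.

Lemma meet_unique x y z : is_meet x y z -> meet x y = z.
Proof.
move=> [zx zy max_z]; apply: prec_anti; last exact: prec_meet.
by apply: max_z; [exact: meet_precl | exact: meet_precr].
Qed.

Lemma meet_l x y : prec x y -> meet x y = x.
Proof. by move=> xy; apply: meet_unique; split=> //; apply: prec_refl. Qed.

Lemma meet_r x y : prec y x -> meet x y = y.
Proof. by move=> yx; apply: meet_unique; split=> //; apply: prec_refl. Qed.

Lemma meet_mull g x y : meet (g * x) (g * y) = g * meet x y.
Proof.
apply: meet_unique; split; rewrite ?prec_mul2l;
  [exact: meet_precl|exact: meet_precr|].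
by move=> w; rewrite -(mulVKg g w) !prec_mul2l; apply: prec_meet.
Qed.

Lemma meet_mulr q x y : meet (x * D q) (y * D q) = meet x y * D q.
Proof.
apply: meet_unique; split; rewrite ?prec_mul2r;
  [exact: meet_precl|exact: meet_precr|].
by move=> w; rewrite -(mulgVK (D q) w) !prec_mul2r; apply: prec_meet.
Qed.

Lemma meetACA x y z w : meet (meet x y) (meet z w) = meet (meet x z) (meet y w).
Proof.
have [lx lz _] := meetP x z; have [ly lw _] := meetP y w.
have [lxz lyw _] := meetP (meet x z) (meet y w).
apply: meet_unique; split.
- exact: prec_meet (prec_trans lxz lx) (prec_trans lyw ly).
- exact: prec_meet (prec_trans lxz lz) (prec_trans lyw lw).
- move=> g gxy gzw; have [gx gy _] := meetP x y; have [gz gw _] := meetP z w.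
  apply: prec_meet; apply: prec_meet.
  + exact: prec_trans gx.
  + exact: prec_trans gz.
  + exact: prec_trans gy.
  + exact: prec_trans gw.
Qed.

(** Conjugation by Delta permutes the finite set of simple elements, so some power fixes them all;
    they generate the monoid, whose fractions fill the group. *)
Lemma ex_central_power :
  exists2 k, (0 < k)%N & forall g, g ^ D k = g.
Proof.
have [_ _ _ _ [_ finD _]] := gg_garside G.
pose S : set G := [set i a | a in [set a | ldvd a Delta]].
have finS : finite_set S by apply: finite_image.
have [|u v _ _|k k0 kS] := @finite_injection_periodic _ S (fun g => g ^ D 1) finS.
- by move=> _ [a /simple_conj_Delta[c Dc def_c] <-]; exists c; rewrite // -def_c.
- exact: conjg_inj.
exists k => // g; have [_ _ /(_ g)[a [b ->]]] := gg_fractions G.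
suff fix_pos h : pos h -> h ^ D k = h by rewrite conjMg conjVg !fix_pos.
move: h; apply: pos_generated => [|g1 g2 E1 E2|c Dc]; first exact: conj1g.
  by rewrite conjMg E1 E2.
by rewrite -[RHS](kS (i c)) ?iter_conj_expgz ?GRing.mulr1 //; exists c.
Qed.

End GarsideOrder.

(** * Cycling and transport of conjugators *)

Section Cycling.
Context {G : garsideGroup}.
Implicit Types (x y z u v w g : G) (p q : int) (n m : nat).

Local Notation i := (@gg_incl G).
Local Notation pos := (range i).
Local Notation D := (expgz (@DeltaG G)).
Local Notation cyclings := (foldl (fun z q => cycling q z)).

Definition transport q y u : G :=
  (meet y (D q))^-1 * u * meet (y ^ u) (D q).

Lemma transportE q y u :
  transport q y u = (meet y (D q))^-1 * meet (y * u) (u * D q).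
Proof. by rewrite (conjgC y) meet_mull mulgA. Qed.

Lemma cycling_conj q y u : cycling q (y ^ u) = cycling q y ^ transport q y u.
Proof. by rewrite /cycling /transport !conjgM conjgK. Qed.

Lemma transport_prec q y u v :
  prec u v -> prec (transport q y u) (transport q y v).
Proof.
move=> uv; rewrite !transportE prec_mul2l; apply: prec_meet.
  by apply: prec_trans (meet_precl _ _) _; rewrite prec_mul2l.
by apply: prec_trans (meet_precr _ _) _; rewrite prec_mul2r.
Qed.

Lemma transport_meet q y u v :
  transport q y (meet u v) = meet (transport q y u) (transport q y v).
Proof. by rewrite !transportE meet_mull meetACA meet_mull meet_mulr. Qed.

Lemma transport_expgz q y p : transport q y (D p) = D p.
Proof. by rewrite transportE (expgz_comm p q) meet_mulr mulKg. Qed.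

Lemma transport1 q y : transport q y 1 = 1.
Proof. exact: (transport_expgz q y 0). Qed.

(** With [y] seen as a conjugator from [y] to itself, each property of transport becomes one of
    cycling. *)
Lemma transport_self q y : transport q y y = cycling q y.
Proof. by rewrite /transport /cycling [y ^ y]mulKg -mulgA. Qed.

Lemma transport_inj q y u v : y ^ u = y ^ v ->
  transport q y u = transport q y v -> u = v.
Proof. by rewrite /transport => -> /mulIg/mulgI. Qed.

(* Transport along the cycling of order [p] sends the conjugator
   [meet y Delta^q] to [meet (cycling p y) Delta^q]. *)
Lemma cycling_comm p q y : cycling p (cycling q y) = cycling q (cycling p y).
Proof.
by rewrite {2}/cycling cycling_conj transport_meet transport_self transport_expgz.
Qed.

Lemma iter_cycling_comm n p q y :
  iter n (cycling p) (cycling q y) = cycling q (iter n (cycling p) y).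
Proof. by elim: n => //= n ->; rewrite cycling_comm. Qed.

Lemma periodic_cycling p q y : periodic p y -> periodic p (cycling q y).
Proof. by move=> [N N0 fix_y]; exists N => //; rewrite iter_cycling_comm fix_y. Qed.

Lemma periodic_iter p q n y : periodic p y -> periodic p (iter n (cycling q) y).
Proof. by move=> per; elim: n => //= n; apply: periodic_cycling. Qed.

Lemma iter_mul_fix (T : Type) (f : T -> T) N n (a : T) :
  iter N f a = a -> iter (n * N) f a = a.
Proof. by move=> fixa; elim: n => // n IHn; rewrite mulSn iterD IHn. Qed.

Lemma cycling_inj q y z : periodic q y -> periodic q z ->
  cycling q y = cycling q z -> y = z.
Proof.
move=> [[//|N] _ fix_y] [[//|N'] _ fix_z] eqc.
(* Both points are fixed by the product of their periods; as it is positive, a first cycling can be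
   split off on each side. *)
rewrite -(iter_mul_fix N'.+1 fix_y) -(iter_mul_fix N.+1 fix_z) mulnC.
by rewrite !mulSn addSn !iterSr eqc.
Qed.

Lemma expgz_prec_cycling q p y : prec (D p) y -> prec (D p) (cycling q y).
Proof.
by rewrite -transport_self -{2}(transport_expgz q y p); apply: transport_prec.
Qed.

Lemma cycling_prec_expgz q p y : prec y (D p) -> prec (cycling q y) (D p).
Proof.
by rewrite -transport_self -{2}(transport_expgz q y p); apply: transport_prec.
Qed.

(** Above [D q] every meet is [D q] itself, so cycling is conjugation by it, which has finite
    order. *)
Lemma iter_cycling_low q y n : prec (D q) y ->
  iter n (cycling q) y = iter n (fun g => g ^ D q) y.
Proof.
move=> qy; elim: n => //= n <-; rewrite /cycling meet_r //.
by elim: n => //= n; apply: expgz_prec_cycling.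
Qed.

Lemma iter_cycling_high q y n : prec y (D q) -> iter n (cycling q) y = y.
Proof.
by move=> yq; elim: n => //= n ->; rewrite /cycling meet_l // [y ^ y]mulKg.
Qed.

Lemma ex_central_powers :
  exists2 k, (0 < k)%N & forall q g, g ^ D (k%:Z * q)%R = g.
Proof.
have [k k0 central] := @ex_central_power G; exists k => // q g.
have centralV h : h ^ D (- k%:Z)%R = h by rewrite expgzN -{1}(central h) conjgK.
elim: q => [|n IHn|n IHn]; first by rewrite GRing.mulr0 conjg1.
  by rewrite -addn1 PoszD GRing.mulrDr GRing.mulr1 expgzD conjgM IHn.
by rewrite -addn1 PoszD GRing.opprD GRing.mulrDr GRing.mulrN1 expgzD conjgM IHn.
Qed.

Lemma periodic_low q y : prec (D q) y -> periodic q y.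
Proof.
move=> qy; have [k k0 central] := ex_central_powers.
by exists k => //; rewrite iter_cycling_low // iter_conj_expgz central.
Qed.

Lemma periodic_high q y : prec y (D q) -> periodic q y.
Proof. by move=> yq; exists 1%N => //; apply: iter_cycling_high. Qed.

(** * Conjugacy classes and nonemptiness of [Cstar] *)

Lemma conj_class_refl x : conj_class x x.
Proof. by exists 1; rewrite ?conjg1. Qed.

Lemma conj_class_sym x y : conj_class x y -> conj_class y x.
Proof. by move=> [u _ <-]; exists u^-1; rewrite ?conjgK. Qed.

Lemma conj_class_trans y x z : conj_class x y -> conj_class y z -> conj_class x z.
Proof. by move=> [u _ <-] [v _ <-]; exists (u * v); rewrite ?conjgM. Qed.

Lemma conj_classJ x u : conj_class x (x ^ u).
Proof. by exists u. Qed.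

Lemma Cstar_conj x y : conj_class x y -> Cstar y = Cstar x.
Proof.
move=> xy; have yx := conj_class_sym xy.
apply/seteqP; split=> z [conj_z per_z]; split=> //.
  exact: conj_class_trans conj_z.
exact: conj_class_trans conj_z.
Qed.

Lemma Cstar_eq x y : Cstar x y -> Cstar y = Cstar x.
Proof. by move=> [xy _]; apply: Cstar_conj. Qed.

Lemma Cstar_cycling x y q : Cstar x y -> Cstar x (cycling q y).
Proof.
move=> [xy per_y]; split; first exact: conj_class_trans xy (conj_classJ _ _).
by move=> p _; apply: periodic_cycling; apply: per_y.
Qed.

Lemma Cstar_cyclings x y qs : Cstar x y -> Cstar x (cyclings y qs).
Proof. by elim: qs y => //= q qs IHqs y /(Cstar_cycling q)/IHqs. Qed.

(** Between [D (-n)] and [D n] only finitely many orders need work. They are treated in turn by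
    iterated cycling, which stays in a finite interval and, by commutation, keeps the periodicity
    already gained. *)
Lemma Cstar_nonempty x : exists y, Cstar x y.
Proof.
have [n [low_x high_x]] := bounded x.
have ex_periodic (qs : seq int) : exists y, [/\ conj_class x y, prec (D (- n%:Z)%R) y,
    prec y (D n) & forall q, q \in qs -> periodic q y].
  elim: qs => [|q qs [y [xy low_y high_y per_y]]].
    by exists x; split=> //; apply: conj_class_refl.
  pose I := [set z | [/\ conj_class x z, prec (D (- n%:Z)%R) z & prec z (D n)]].
  have Iy : I y by [].
  have finI : finite_set I.
    by apply: sub_finite_set (finite_interval (D (- n%:Z)%R) (D n)) => z [].
  have cycI z : I z -> I (cycling q z).
    move=> [xz low_z high_z]; split; first exact: conj_class_trans xz (conj_classJ _ _).
      exact: expgz_prec_cycling.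
    exact: cycling_prec_expgz.
  have [j [N N0 per_q]] := iter_eventually_periodic finI cycI Iy.
  exists (iter j (cycling q) y); have [? ? ?] := iter_in cycI j Iy.
  split=> // p; rewrite inE => /orP[/eqP->|/per_y]; first by exists N.
  exact: periodic_iter.
(* The list runs from [-n] to [n-1]; the bounds on [y] settle all other orders. *)
have [y [xy low_y high_y per_y]] :=
  ex_periodic [seq (j%:Z - n%:Z)%R | j <- iota 0 n.*2].
exists y; split=> // q _.
have [qn|nq] := boolP (q <= - n%:Z)%R.
  by apply: periodic_low; apply: prec_trans low_y; apply: prec_expgz.
have [nq'|qn'] := boolP (n%:Z <= q)%R.
  by apply: periodic_high; apply: prec_trans (prec_expgz nq').
apply: per_y; apply/mapP; exists (`|(q + n%:Z)%R|)%N; last by lia.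
by rewrite mem_iota; lia.
Qed.

Lemma conj_class_pos y z : conj_class y z -> exists2 u, pos u & z = y ^ u.
Proof.
move=> [g _ <-]; have [k k0 central] := ex_central_powers.
(* Multiplying the conjugator by a large central power of Delta makes it positive without changing
   its action. *)
have [n low_g] := lower_bounded g; exists (D (k%:Z * n%:Z)%R * g); last first.
  by rewrite conjgM central.
rewrite -prec1 -[1](mulgV (D (k%:Z * n%:Z)%R)) -expgzN prec_mul2l.
by apply: prec_trans low_g; apply: prec_expgz; nia.
Qed.

(** * Iterated transport and finiteness of [Cstar] *)

Definition transport_pair q (yu : G * G) :=
  (cycling q yu.1, transport q yu.1 yu.2).

Local Notation iter_tr n q y u := (iter n (transport_pair q) (y, u)).2.

Lemma iter_transport_pair1 n q y u :
  (iter n (transport_pair q) (y, u)).1 = iter n (cycling q) y.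
Proof. by elim: n => //= n ->. Qed.

Lemma iter_trS n q y u :
  iter_tr n.+1 q y u = transport q (iter n (cycling q) y) (iter_tr n q y u).
Proof. by rewrite /= iter_transport_pair1. Qed.

Lemma iter_cycling_conj n q y u :
  iter n (cycling q) (y ^ u) = iter n (cycling q) y ^ iter_tr n q y u.
Proof. by elim: n => // n IHn; rewrite iter_trS !iterS IHn cycling_conj. Qed.

Lemma iter_tr_prec n q y u v : prec u v -> prec (iter_tr n q y u) (iter_tr n q y v).
Proof. by move=> uv; elim: n => // n IHn; rewrite !iter_trS; apply: transport_prec. Qed.

Lemma iter_tr_meet n q y u v :
  iter_tr n q y (meet u v) = meet (iter_tr n q y u) (iter_tr n q y v).
Proof. by elim: n => // n IHn; rewrite !iter_trS IHn transport_meet. Qed.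

Lemma iter_tr_expgz n q y p : iter_tr n q y (D p) = D p.
Proof. by elim: n => // n IHn; rewrite iter_trS IHn transport_expgz. Qed.

Lemma iter_tr1 n q y : iter_tr n q y 1 = 1.
Proof. exact: (iter_tr_expgz n q y 0). Qed.

Lemma iter_tr_interval n q y u m : prec 1 u -> prec u (D m) ->
  prec 1 (iter_tr n q y u) /\ prec (iter_tr n q y u) (D m).
Proof.
move=> /(iter_tr_prec n q y) + /(iter_tr_prec n q y).
by rewrite iter_tr1 iter_tr_expgz.
Qed.

(** A repetition in [v] makes a product of consecutive [r n] equal to 1, and no product of positive
    elements is 1 unless its factors are. *)
Lemma pos_growth_trivial (A : set G) (v r : nat -> G) :
  finite_set A -> (forall n, A (v n)) -> (forall n, pos (r n)) ->
  (forall n, v n.+1 = r n * v n) -> exists n, r n = 1.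
Proof.
move=> finA vA pos_r def_v; have [j [k [jk eqv]]] := finite_sequence_repeats finA vA.
have [R posR def_vk] : exists2 R, pos R & v k = R * v j.+1.
  rewrite -(subnK jk); elim: (k - j.+1)%N => [|d [R posR defR]].
    by exists 1; rewrite ?mul1g //; apply: pos1.
  exists (r (d + j.+1)%N * R); first exact: posM.
  by rewrite addSn def_v defR mulgA.
exists j; have: R * r j = 1.
  by apply: (mulIg (v j)); rewrite mul1g -mulgA -def_v -def_vk -eqv.
by move=> Rr; have := pos_conical posR (pos_r j) Rr => R1; rewrite -Rr R1 mul1g.
Qed.

(** Going on from the [n]-th iterate to the [n * N]-th returns to [y]. *)
Lemma iter_cycling_back (P : G -> Prop) q y n : periodic q y ->
  (forall z, P z -> P (cycling q z)) -> P (iter n (cycling q) y) -> P y.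
Proof.
move=> [N N0 fix_y] Pc Pn; rewrite -(iter_mul_fix n fix_y).
rewrite -(@subnK n (n * N)); last by rewrite leq_pmulr.
rewrite iterD; elim: (_ - _)%N => //= d; exact: Pc.
Qed.

(* If [Delta^p] did not divide [y], every cycling of order [p] would multiply
   the conjugator transported from [y] to [z] by a nontrivial positive element,
   up to conjugation by a power of [Delta]; but that conjugator stays in a
   finite interval. *)
Lemma summit_lower y z p : periodic p y -> conj_class y z ->
  prec (D p) z -> prec (D p) y.
Proof.
move=> per_y /conj_class_pos[u pos_u ->] pz.
have [m um] := pos_bounded pos_u.
pose c n := iter n (cycling p) y; pose U n := iter_tr n p y u.
(* The iterates of [y ^ u] stay above [D p], so each transport puts a factor [D p] on the right of
   [U n]; conjugating by [D (- (n * p))] absorbs these factors and leaves pure left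
   multiplication. *)
have [n] : exists n, ((meet (c n) (D p))^-1 * D p) ^ D (- (n.+1%:Z * p))%R = 1.
  apply: (@pos_growth_trivial _ (fun n => U n ^ D (- (n%:Z * p))%R) _
    (finite_interval 1 (D m))).
  - move=> n; have [|low_U high_U] := @iter_tr_interval n p y u m _ um.
      by rewrite prec1.
    split; first by rewrite -(conj1g (D (- (n%:Z * p))%R)) prec_conj2.
    by rewrite -(expgz_conj m (- (n%:Z * p))%R) prec_conj2.
  - by move=> n; rewrite pos_conj_expgz; apply: meet_precr.
  - move=> n; rewrite {1}/U iter_trS -/(c n) -/(U n) /transport.
    rewrite -iter_cycling_conj [meet (iter _ _ _) _]meet_r; last first.
      by elim: (n) => //= k; apply: expgz_prec_cycling.
    have -> : (- (n%:Z * p) = p + - (n.+1%:Z * p))%R by nia.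
    by rewrite expgzD conjgM -conjMg /(U n ^ _) !mulgA mulgK.
move/eqP; rewrite conjg_eq1 => /eqP/mulg1_eq; rewrite invgK => eq_meet.
apply: (@iter_cycling_back (prec (D p)) p y n) => // [g|].
  exact: expgz_prec_cycling.
by rewrite -eq_meet; apply: meet_precl.
Qed.

(** As for [summit_lower], but untwisted: [z] is fixed by cycling and is its own meet with [D p], so
    transport multiplies [U n] on the left by [(meet (c n) (D p))^-1 * c n]. *)
Lemma summit_upper y z p : periodic p y -> conj_class y z ->
  prec z (D p) -> prec y (D p).
Proof.
move=> per_y /conj_class_pos[u pos_u ->] zp.
have [m um] := pos_bounded pos_u.
pose c n := iter n (cycling p) y; pose U n := iter_tr n p y u.
have [n] : exists n, (meet (c n) (D p))^-1 * c n = 1.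
  apply: (@pos_growth_trivial _ U _ (finite_interval 1 (D m))).
  - by move=> n; apply: iter_tr_interval; rewrite ?prec1.
  - by move=> n; apply: meet_precl.
  - move=> n; rewrite {1}/U iter_trS -/(c n) -/(U n) /transport.
    rewrite [meet (_ ^ _) _]meet_l; last by rewrite -iter_cycling_conj iter_cycling_high.
    by rewrite -[RHS]mulgA (conjgC (c n)) [RHS]mulgA.
move/mulg1_eq; rewrite invgK => eq_meet.
apply: (@iter_cycling_back (prec^~ (D p)) p y n) => // [g|].
  exact: cycling_prec_expgz.
by rewrite -/(c n) -eq_meet; apply: meet_precr.
Qed.

Lemma finite_Cstar x : finite_set (Cstar x).
Proof.
have [n [low_x high_x]] := bounded x.
apply: sub_finite_set (finite_interval (D (- n%:Z)%R) (D n)) => y [/conj_class_sym yx per_y].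
by split; [apply: summit_lower yx low_x|apply: summit_upper yx high_x]; apply: per_y.
Qed.

(** * Periodicity of transport and closure of summit conjugators under meets *)

Definition Cstar_pairs x m : set (G * G) :=
  [set yu | [/\ Cstar x yu.1, Cstar x (yu.1 ^ yu.2), prec 1 yu.2 & prec yu.2 (D m)]].

Lemma transport_pairs_periodic x m q : exists2 N, (0 < N)%N &
  forall yu, Cstar_pairs x m yu -> iter N (transport_pair q) yu = yu.
Proof.
apply: finite_injection_periodic.
- apply: sub_finite_set
    (finite_setX (finite_Cstar x) (finite_interval 1 (D m))).
  by case=> y u [].
- case=> y u [/= Cy Cyu u1 um]; split; rewrite /= -?cycling_conj.
  + exact: Cstar_cycling.
  + exact: Cstar_cycling.
  + by rewrite -[X in prec X _](transport1 q y); apply: transport_prec.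
  + by rewrite -[X in prec _ X](transport_expgz q y m); apply: transport_prec.
- case=> y u [z v] [/= [_ Cy] [_ Cyu] _ _] [/= [_ Cz] [_ Czv] _ _].
  rewrite /transport_pair /= => -[eqc eqt].
  have yz : y = z by apply: (@cycling_inj q) => //; [apply: Cy|apply: Cz].
  (* Cancelling transport requires equal targets [y ^ u] and [y ^ v]; these are periodic and have
     the same cycling. *)
  subst z; congr pair; apply: transport_inj (eqt).
  apply: (@cycling_inj q); [exact: Cyu|exact: Czv|].
  by rewrite !cycling_conj -eqt.
Qed.

(** For each order, one iterate of transport fixes both [(y, u)] and [(y, v)]; as it preserves
    meets, it also fixes the meet, so the target is periodic. *)
Lemma Cstar_meet x y u v : pos u -> pos v ->
  Cstar x y -> Cstar x (y ^ u) -> Cstar x (y ^ v) -> Cstar x (y ^ meet u v).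
Proof.
move=> pos_u pos_v Cy Cyu Cyv; split.
  by apply: conj_class_trans (conj_classJ _ _); case: Cy.
move=> q _; have [m um] := pos_bounded pos_u; have [n vn] := pos_bounded pos_v.
have [N N0 fixN] := transport_pairs_periodic x (maxn m n) q; exists N => //.
have fix_u : iter N (transport_pair q) (y, u) = (y, u).
  apply: fixN; split; rewrite ?prec1 //.
  by apply: (prec_trans um); apply: prec_expgz; lia.
have fix_v : iter N (transport_pair q) (y, v) = (y, v).
  apply: fixN; split; rewrite ?prec1 //.
  by apply: (prec_trans vn); apply: prec_expgz; lia.
by rewrite iter_cycling_conj iter_tr_meet -(iter_transport_pair1 _ _ _ u) fix_u fix_v.
Qed.

Lemma simpleP u : simple u <-> prec 1 u /\ prec u (@DeltaG G).
Proof.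
rewrite prec1; split=> [[a [b def_ab] <-]|[[a _ <-] [b _ def_b]]].
  by split; [exists a|exists b; rewrite // /DeltaG def_ab inclM mulKg].
exists a => //; exists b; apply: incl_inj.
by rewrite inclM def_b mulVKg.
Qed.

Lemma Cstar_refl x y : Cstar x y -> Cstar y y.
Proof. by move=> Cy; rewrite (Cstar_eq Cy). Qed.

(* Transport is order preserving and periodic, so it cannot create a smaller
   summit conjugator. *)
Lemma minimal_simples_transport q z a : Cstar z z ->
  minimal_simples z a -> minimal_simples (cycling q z) (transport q z a).
Proof.
move=> Cz [[simple_a a1 Cza] min_a].
have Ccz : Cstar (cycling q z) = Cstar z by apply: Cstar_eq; apply: Cstar_cycling.
have summit_pair y v : Cstar z y -> simple v -> Cstar z (y ^ v) ->
    Cstar_pairs z 1 (y, v).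
  by move=> Cy /simpleP[v1 vD] Cyv; split=> //=; rewrite expg1.
have [[//|N] _ fixN] := transport_pairs_periodic z 1 q.
have fix_a := fixN _ (summit_pair _ _ Cz simple_a Cza).
have simple_transport y v : simple v -> simple (transport q y v).
  move=> /simpleP[v1 vD]; apply/simpleP.
  split; first by rewrite -[X in prec X _](transport1 q y); apply: transport_prec.
  by rewrite -[X in prec _ X](transport_expgz q y 1); apply: transport_prec.
have simple_a' := simple_transport z a simple_a.
have C_a' : Cstar z (cycling q z ^ transport q z a).
  by rewrite -cycling_conj; apply: Cstar_cycling.
(* A trivial transport would give [y ^ v] and [y] the same cycling, hence make them equal, and then
   [v = 1] by injectivity of transport. *)
have neq1 y v : simple v -> Cstar z y -> Cstar z (y ^ v) -> v <> 1 ->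
    transport q y v <> 1.
  move=> simple_v Cy Cyv v1 tr1; apply: v1; apply: (@transport_inj q y).
    rewrite conjg1; apply: (@cycling_inj q).
    - by case: Cyv => _; apply.
    - by case: Cy => _; apply.
    - by rewrite cycling_conj tr1 conjg1.
  by rewrite tr1 transport1.
split; first by split=> //; [apply: neq1 Cza a1|rewrite Ccz].
move=> b [simple_b b1]; rewrite Ccz => Ccb ba'.
have fix_b := fixN _ (summit_pair _ _ (Cstar_cycling q Cz) simple_b Ccb).
rewrite iterSr /= in fix_a.
(* The period is [N.+1], so [N] further transports bring [b] back to a conjugator [b0] at [z] below
   [a]. Minimality gives [b0 = a], and one more transport gives back [b]. *)
pose b0 := iter_tr N q (cycling q z) b.
have cycN : iter N (cycling q) (cycling q z) = z.
  by rewrite -(iter_transport_pair1 N q _ (transport q z a)) fix_a.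
have simple_b0 : simple b0.
  by rewrite /b0; elim: (N) => // n; rewrite iter_trS; apply: simple_transport.
have b0_neq1 : b0 <> 1.
  move=> b01; apply: b1; have := congr1 snd fix_b.
  by rewrite iter_trS /= -/b0 b01 transport1.
have b0a : prec b0 a.
  have := iter_tr_prec N q (cycling q z) ba'.
  by rewrite -/b0 [X in prec _ X -> _](congr1 snd fix_a).
have Cb0 : Cstar z (z ^ b0).
  rewrite -{2}cycN -iter_cycling_conj.
  by elim: (N) => //= n; apply: Cstar_cycling.
have := congr1 snd fix_b; rewrite iter_trS cycN -/b0.
by rewrite (min_a b0).
Qed.

(** * Trajectories inside [Cstar] *)

Lemma trajectory_refl y : trajectory y y.
Proof. by exists [::]. Qed.

Lemma trajectory_trans y x z : trajectory x y -> trajectory y z -> trajectory x z.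
Proof. by move=> [qs _ <-] [rs _ <-]; exists (qs ++ rs); rewrite ?foldl_cat. Qed.

Lemma trajectory_Cstar x y z : Cstar x y -> trajectory y z -> Cstar x z.
Proof. by move=> Cy [qs _ <-]; apply: Cstar_cyclings. Qed.

(** On a periodic point of period [N.+1], one cycling is undone by [N] more of the same order. *)
Lemma trajectory_sym x y z : Cstar x y -> trajectory y z -> trajectory z y.
Proof.
move=> Cy [qs _ <-]; elim: qs y Cy => [|q qs IHqs] y Cy; first exact: trajectory_refl.
apply: trajectory_trans (IHqs _ (Cstar_cycling q Cy)) _.
have [_ /(_ q I)[[//|N] _ fix_y]] := Cy.
exists (nseq N q) => //; rewrite -[RHS]fix_y iterSr.
by elim: N (cycling q y) {fix_y} => //= n IHn w; rewrite IHn -iterSr.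
Qed.

Lemma trajectory_eq x y z : Cstar x y -> trajectory y z -> trajectory z = trajectory y.
Proof.
move=> Cy yz; apply/seteqP; split=> w; first exact: trajectory_trans.
exact: trajectory_trans (trajectory_sym Cy yz).
Qed.

(** This is why one representative per trajectory suffices: [b] is [a] transported along the
    cyclings, which move its target within a trajectory. *)
Lemma minimal_simples_trajectory z y a : Cstar z z -> minimal_simples z a ->
  trajectory z y -> exists2 b, minimal_simples y b & trajectory (z ^ a) (y ^ b).
Proof.
move=> Cz min_a [qs _ <-]; elim: qs z a Cz min_a => [|q qs IHqs] z a Cz min_a.
  by exists a => //; apply: trajectory_refl.
have [|b min_b traj_b] := IHqs _ _ _ (minimal_simples_transport q Cz min_a).
  exact: Cstar_refl (Cstar_cycling q Cz).
exists b => //; apply: trajectory_trans traj_b.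
by exists [:: q] => //=; rewrite cycling_conj.
Qed.

(** * Connectedness of [Cstar] under minimal simple conjugators *)

Lemma ex_pos_length : exists len : G -> nat,
  (forall g h, pos g -> pos h -> (len g + len h <= len (g * h)%g)%N) /\
  (forall g, pos g -> len g = 0%N -> g = 1).
Proof.
have [len [lenM len0]] := ex_length (gg_garside G).
(* [xget] selects the unique preimage in the monoid; its default occurs only at non-positive
   elements. *)
exists (fun g => len (xget 1 [set a | i a = g])).
have lenE a : len (xget 1 [set b | i b = i a]) = len a.
  by congr len; apply: xget_unique => //= b; apply: incl_inj.
split=> [_ _ [a _ <-] [b _ <-]|_ [a _ <-]]; first by rewrite -inclM !lenE.
by rewrite lenE => /len0->; rewrite incl1.
Qed.

Lemma ex_minimal_simple y u : summit_simples y u ->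
  exists2 a, minimal_simples y a & prec a u.
Proof.
have [len [lenM len0]] := ex_pos_length.
have [n] := ubnP (len u); elim: n u => // n IHn u; rewrite ltnS => lenu sum_u.
have [min_u|] := pselect (minimal_simples y u).
  by exists u => //; apply: prec_refl.
move=> not_min; have [v [sum_v vu v_neq_u]] : exists v,
    [/\ summit_simples y v, prec v u & v <> u].
  apply: contrapT => no_v; apply: not_min; split=> // v sum_v vu.
  by apply: contrapT => v_neq_u; apply: no_v; exists v.
have [|a min_a av] := IHn v _ sum_v; last by exists a => //; apply: prec_trans vu.
have pos_v : pos v by case: sum_v => /simpleP[]; rewrite prec1.
apply: leq_trans lenu; rewrite -[u](mulVKg v); apply: leq_trans (lenM _ _ pos_v vu).
rewrite -addn1 leq_add2l lt0n; apply/eqP => /(len0 _ vu)/mulg1_eq.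
by rewrite invgK.
Qed.

(** The candidate is [meet g DeltaG]: it is nontrivial because an atom dividing [g] also divides
    Delta, and [Cstar_meet] makes it a summit conjugator. *)
Lemma ex_minimal_simple_below x y g : Cstar x y -> pos g -> g <> 1 ->
  Cstar x (y ^ g) -> exists2 a, minimal_simples y a & prec a g.
Proof.
move=> Cy pos_g g1 Cyg.
(* Transport fixes Delta, so conjugation by Delta keeps the periods. *)
have Cyd : Cstar x (y ^ DeltaG).
  have [xy per_y] := Cy; split; first exact: conj_class_trans xy (conj_classJ _ _).
  move=> q _; have [N N0 fix_y] := per_y q I; exists N => //.
  by rewrite iter_cycling_conj fix_y -[DeltaG]expg1 (iter_tr_expgz N q y 1).
have [|a min_a ag] := @ex_minimal_simple y (meet g DeltaG).
- split.
  + apply/simpleP; split; last exact: meet_precr.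
    by apply: prec_meet; rewrite prec1 //; apply: pos_Delta.
  + case: pos_g g1 {Cyg} => a _ <- a1 meet1.
    have [b [c [atom_b def_a]]] : exists b c, atom b /\ a = b * c.
      by apply: (atom_factor (gg_garside G)) => a_1; apply: a1; rewrite a_1 incl1.
    case: (atom_b) => b1 _; apply: b1; apply: incl_inj; rewrite incl1.
    apply: prec_anti; last by rewrite prec1; exists b.
    rewrite -meet1; apply: prec_meet; first by rewrite def_a inclM; apply: prec_mulr; exists c.
    have [d def_d] := atom_ldvd_garside (gg_garside G) atom_b.
    by rewrite /DeltaG def_d inclM; apply: prec_mulr; exists d.
  + by rewrite (Cstar_eq Cy); apply: Cstar_meet Cyd => //; apply: pos_Delta.
by exists a => //; apply: prec_trans ag (meet_precl _ _).
Qed.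

(** Any other point is [z ^ g] with [g] positive; splitting minimal simple conjugators off the left
    of [g] shortens it until it is 1. *)
Lemma Cstar_connected x (R : set G) z : R `<=` Cstar x -> R z ->
  (forall y a, R y -> minimal_simples y a -> R (y ^ a)) -> R = Cstar x.
Proof.
move=> RC Rz closedR; apply/seteqP; split=> // w Cw.
have [g pos_g def_w] : exists2 g, pos g & w = z ^ g.
  apply: conj_class_pos; have [xz _] := RC _ Rz; have [xw _] := Cw.
  exact: conj_class_trans (conj_class_sym xz) xw.
have [len [lenM len0]] := ex_pos_length.
have [n] := ubnP (len g); elim: n g z pos_g Rz def_w => // n IHn g z pos_g Rz def_w.
rewrite ltnS => leng.
have [g1|g1] := pselect (g = 1); first by rewrite def_w g1 conjg1.
rewrite def_w in Cw.
have [a min_a ag] := ex_minimal_simple_below (RC _ Rz) pos_g g1 Cw.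
have [[/simpleP[pos_a _] a1 _] _] := min_a; rewrite prec1 in pos_a.
apply: (IHn (a^-1 * g) (z ^ a)) => //; first exact: closedR.
  by rewrite def_w -conjgM mulVKg.
apply: leq_trans leng; rewrite -{2}[g](mulVKg a).
apply: leq_trans (lenM _ _ pos_a ag); rewrite -add1n leq_add2r lt0n.
by apply/eqP => /(len0 _ pos_a).
Qed.

End Cycling.

(** * Invariant, termination and output of the algorithm *)

Section Algorithm.
Context {G : garsideGroup}.
Variable x : G.
Implicit Types (y z u : G) (T : set G) (s t : @state G).

Definition summit_trajectories : set (set G) := [set trajectory y | y in Cstar x].

Lemma summit_trajectoriesP T y : summit_trajectories T -> T y ->
  Cstar x y /\ T = trajectory y.
Proof.
move=> [z Cz <-] zy; split; first exact: trajectory_Cstar zy.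
by rewrite (trajectory_eq Cz zy).
Qed.

Lemma finite_summit_trajectories : finite_set summit_trajectories.
Proof. by apply: finite_image; apply: finite_Cstar. Qed.

(** Invariant of all runs. A processed trajectory remembers only that some representative had all
    its successors added; the nonemptiness clause supplies the starting point for connectedness. *)
Definition sound_state s :=
  [/\ trajs s `<=` summit_trajectories, exists T, trajs s T &
      forall T, processed s T -> exists2 y, T y &
        forall u, minimal_simples y u -> trajs s (trajectory (y ^ u))].

Lemma sound_initial s : initial x s -> sound_state s.
Proof.
case=> y Cy; split=> //=; last by exists (trajectory y).
by move=> _ ->; exists y.
Qed.

Lemma sound_step s t : step s t -> sound_state s -> sound_state t.
Proof.
case=> T y trajT _ Ty [traj_s _ proc_s]; split=> /=.
- move=> T' [/traj_s//|[u [[_ _ Cyu] _] <-]]; exists (y ^ u) => //.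
  by have [Cy _] := summit_trajectoriesP (traj_s _ trajT) Ty; rewrite -(Cstar_eq Cy).
- by exists T; left.
- move=> T' [/proc_s[z T'z min_z]|->]; first by exists z => // u /min_z; left.
  by exists y => // u min_u; right; exists u.
Qed.

Lemma sound_reachable t : reachable x t -> sound_state t.
Proof.
move=> [s /sound_initial + run]; elim: run => // {}s {}t.
- exact: sound_step.
- by move=> w _ IHs _ IHw /IHs/IHw.
Qed.

Lemma Acc_sound s : sound_state s -> Acc (fun t' t => step t t') s.
Proof.
have /finite_seqP[L defL] := finite_summit_trajectories.
(* The measure counts unprocessed entries of a list of all summit trajectories; a step processes a
   listed one. *)
pose todo s := count (fun T => `[< ~ processed s T >]) L.
have [n] := ubnP (todo s); elim: n s => [|n IHn] s; first by rewrite ltn0.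
rewrite ltnS => todo_s sound_s.
apply: Acc_intro => t st; apply: IHn (sound_step st sound_s).
apply: leq_trans todo_s; case: st sound_s => T y trajT unproc _ [traj_s _ _].
have LT : T \in L by have := traj_s _ trajT; rewrite defL.
rewrite /todo; set P := fun T' => _; set P' := fun T' => _.
have P'P : subpred (predU P (pred1 T)) P'.
  by move=> T' /orP[/asboolP nT'|/eqP->]; apply/asboolP => // ?; apply: nT'; left.
have disjoint : count (predI P (pred1 T)) L = 0%N.
  rewrite -(count_pred0 L); apply: eq_count => T'.
  by apply/andP => -[/asboolP nT' /eqP eqT]; apply: nT'; right.
apply: leq_trans (sub_count P'P L).
by rewrite -[leqRHS]addn0 -disjoint count_predUI -addn1 leq_add2l -has_count has_pred1.
Qed.

(** The output is closed under minimal simple conjugators: such an [a] at [y] transports to some [b]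
    at the processed representative [w], and [y ^ a] lies on the trajectory of [w ^ b] by
    symmetry. *)
Lemma output_sound s : sound_state s -> halted s -> output s = Cstar x.
Proof.
move=> [traj_s [T trajT] proc_s] halt.
have [z Cz defT] := traj_s T trajT.
apply: (@Cstar_connected _ x _ z).
- by move=> y [T' /traj_s sumT' /(summit_trajectoriesP sumT')[]].
- by exists T; rewrite // -defT; apply: trajectory_refl.
- move=> y a [T' trajT' T'y] min_a.
  have [Cy defT'] := summit_trajectoriesP (traj_s _ trajT') T'y.
  have [w T'w min_w] := proc_s T' (halt _ trajT').
  rewrite defT' in T'w.
  have [b min_b traj_b] := minimal_simples_trajectory (Cstar_refl Cy) min_a T'w.
  exists (trajectory (w ^ b)); first exact: min_w.
  have [[_ _ Cya] _] := min_a.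
  exact: trajectory_sym Cya traj_b.
Qed.

End Algorithm.

Theorem mainTheorem6 (G : garsideGroup) (x : G) :
  terminates_and_returns x (Cstar x).
Proof.
split.
- by have [y Cy] := Cstar_nonempty x; eexists; apply: (Initial Cy).
- by move=> s /sound_initial; apply: Acc_sound.
- move=> t /sound_reachable[traj_t _ _]; split.
    exact: sub_finite_set traj_t (finite_summit_trajectories x).
  move=> T /traj_t[y Cy <-]; apply: sub_finite_set (finite_Cstar x) => z.
  exact: trajectory_Cstar.
- move=> t /sound_reachable[traj_t _ _] not_halted.
  have [T trajT unproc] : exists2 T, trajs t T & ~ processed t T.
    apply: contrapT => noT; apply: not_halted => T trajT.
    by apply: contrapT => unproc; apply: noT; exists T.
  have [y _ defT] := traj_t T trajT.
  by eexists; apply: (Step trajT unproc (y := y)); rewrite -defT; apply: trajectory_refl.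
- by move=> t /sound_reachable; apply: output_sound.
Qed.
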